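(* Let $f:\mathbb{R}\to\mathbb{R}$ be the one-hidden-layer neural network $f(x)=W^1\phi(W^0x+b^0)+b^1$, where $\phi:\mathbb{R}^2\to\mathbb{R}^2$ applies $\tanh$ to each coordinate and $$W^0=\begin{bmatrix}-1\\-1\end{bmatrix},\quad b^0=\begin{bmatrix}-1\\1\end{bmatrix},\quad W^1=\begin{bmatrix}-1&1\end{bmatrix},\quad b^1=-0.5 .$$ Let $T=(e_1-e_2)(e_1-e_2)^\top\in\mathcal{T}_2$. Then $P_1(L^2,T)\preceq 0$ for arbitrarily small $L^2>0$, i.e. for every $L>0$, whereas an arbitrarily small $L>0$ is not an upper bound on the Lipschitz constant of $f$, i.e. there is $L>0$ for which $|f(x)-f(y)|\le L|x-y|$ fails for some $x,y\in\mathbb{R}$. Consequently, the existence of $T\in\mathcal{T}_n$ with $P_1(L^2,T)\preceq0$ does not in general imply that $L$ is an upper bound on the Lipschitz constant of the network.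
   Context: $e_i$ denotes the $i$-th standard basis vector, and $\preceq 0$ means negative semidefinite. The set of symmetric coupling matrices is $$\mathcal{T}_n=\Big\{T\in\mathbb{R}^{n\times n}\ \Big|\ T=\sum_{i=1}^n\lambda_{ii}e_ie_i^\top+\sum_{1\le i<j\le n}\lambda_{ij}(e_i-e_j)(e_i-e_j)^\top,\ \lambda_{ij}\ge 0\Big\}.$$ The activation function $\tanh$ is slope-restricted with $\alpha=0$ and $\beta=1$, i.e. $0\le\frac{\tanh(x)-\tanh(y)}{x-y}\le 1$ for all real $x\neq y$. For a one-hidden-layer network with weights $W^0,W^1$ whose activation function is slope-restricted with bounds $\alpha,\beta$, $$P_1(L^2,T)=\begin{bmatrix}-2\alpha\beta{W^0}^\top TW^0-L^2I&(\alpha+\beta){W^0}^\top T\\(\alpha+\beta)TW^0&-2T+{W^1}^\top W^1\end{bmatrix},$$ and here it is taken with $\alpha=0$, $\beta=1$. *)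

(* Defs.v *)
From mathcomp Require Import all_boot all_order all_algebra.
From mathcomp Require Import reals sequences exp.

Set Implicit Arguments.
Unset Strict Implicit.
Unset Printing Implicit Defensive.

Import Order.TTheory GRing.Theory Num.Theory.
Local Open Scope ring_scope.

Definition tanh (R : realType) (x : R) : R :=
  (expR x - expR (- x)) / (expR x + expR (- x)).

Definition slope_restricted (R : realType) (alpha beta : R) (phi : R -> R) : Prop :=
  forall x y : R, x != y -> alpha <= (phi x - phi y) / (x - y) <= beta.

(* The i-th standard basis vector, as a column; indices start at 0. *)
Definition basis (R : realType) (n : nat) (i : 'I_n) : 'cV[R]_n := delta_mx i 0.

(* The set of symmetric coupling matrices. Only the entries of [lam] on and
   above the diagonal are used. *)
Definition coupling (R : realType) (n : nat) (T : 'M[R]_n) : Prop :=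
  exists lam : 'I_n -> 'I_n -> R,
    (forall i j : 'I_n, (i <= j)%N -> 0 <= lam i j) /\
    T = \sum_(i < n) lam i i *: (basis R i *m (basis R i)^T)
        + \sum_(i < n) \sum_(j < n | (i < j)%N)
            lam i j *: ((basis R i - basis R j) *m (basis R i - basis R j)^T).

Definition neg_semidef (R : realType) (n : nat) (A : 'M[R]_n) : Prop :=
  A^T = A /\ forall v : 'cV[R]_n, (v^T *m A *m v) 0 0 <= 0.

Definition P1 (R : realType) (n0 n1 n2 : nat) (alpha beta : R)
    (W0 : 'M[R]_(n1, n0)) (W1 : 'M[R]_(n2, n1)) (rho : R) (T : 'M[R]_n1) :
    'M[R]_(n0 + n1) :=
  block_mx
    (- (2 * alpha * beta) *: (W0^T *m T *m W0) - rho%:M)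
    ((alpha + beta) *: (W0^T *m T))
    ((alpha + beta) *: (T *m W0))
    (- (2 *: T) + W1^T *m W1).

Definition network (R : realType) (n0 n1 n2 : nat) (phi : R -> R)
    (W0 : 'M[R]_(n1, n0)) (b0 : 'cV[R]_n1)
    (W1 : 'M[R]_(n2, n1)) (b1 : 'cV[R]_n2) (x : 'cV[R]_n0) : 'cV[R]_n2 :=
  W1 *m map_mx phi (W0 *m x + b0) + b1.

(* The norm that MathComp-Analysis puts on matrices is the sup norm. *)
Definition enorm (R : realType) (n : nat) (v : 'cV[R]_n) : R :=
  Num.sqrt (\sum_(i < n) v i 0 ^+ 2).

Definition lipschitz_bound (R : realType) (n m : nat) (L : R)
    (F : 'cV[R]_n -> 'cV[R]_m) : Prop :=
  forall x y : 'cV[R]_n, enorm (F x - F y) <= L * enorm (x - y).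

(* Main.v *)
From mathcomp Require Import normedtype derive realfun.
Require Import Defs.
From mathcomp Require Import all_boot all_order all_algebra.
From mathcomp Require Import reals sequences exp.
From mathcomp Require Import ring lra.

Import Order.TTheory GRing.Theory Num.Theory.
Import numFieldNormedType.Exports.
Local Open Scope ring_scope.

(** The vector (1, 1) lies in the kernel of T = (e_1 - e_2)(e_1 - e_2)^T, so the
off-diagonal blocks of P_1 vanish because W^0 is a multiple of it, and
W^1 = -(e_1 - e_2)^T makes the lower right block -2T + T = -T.  Hence P_1 is
diag(-L^2, -T), which is negative semidefinite for every L.  The network itself
is not constant, since f(0) - f(1) = 2 tanh 1 - tanh 2 = 2 (tanh 1)^3 / (1 + (tanh 1)^2) > 0. *)

Lemma expR_addN_gt0 (R : realType) (x : R) : 0 < expR x + expR (- x).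
Proof. by rewrite addr_gt0 ?expR_gt0. Qed.

Lemma is_derive_tanh (R : realType) (x : R) :
  is_derive x 1 (@tanh R) (1 - tanh x ^+ 2).
Proof.
have dN : is_derive x 1 (fun y : R => expR (- y)) (- expR (- x)).
  rewrite -mulrN1.
  exact: (is_derive1_comp (f := expR) (g := -%R)).
have ne0 : expR x + expR (- x) != 0 by rewrite gt_eqF ?expR_addN_gt0.
have dS : is_derive x 1 (fun y : R => expR y + expR (- y)) (expR x - expR (- x)).
  exact: (is_deriveD (is_derive_expR x) dN).
have dV := is_deriveV (f := fun y => expR y + expR (- y)) ne0 dS.
have dB : is_derive x 1 (fun y : R => expR y - expR (- y)) (expR x + expR (- x)).
  rewrite -(opprK (expR (- x))).
  exact: (is_deriveB (is_derive_expR x) dN).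
apply: (is_derive_eq (is_deriveM dB dV)).
by rewrite /tanh /GRing.scale /=; field.
Qed.

Lemma tanh_sqr_le1 (R : realType) (x : R) : tanh x ^+ 2 <= 1.
Proof.
rewrite /tanh expr_div_n ler_pdivrMr ?exprn_gt0 ?expR_addN_gt0 // mul1r.
(* With a = e^x and b = e^(-x), the claim is (a - b)^2 <= (a + b)^2, and the two sides differ by
   4ab. *)
have := mulr_gt0 (expR_gt0 x) (expR_gt0 (- x)).
by nra.
Qed.

(** By the mean value theorem each slope equals 1 - (tanh c)^2 for some c, which lies in [0, 1]. The
    quotient is symmetric in x and y, so y < x may be assumed. *)
Lemma slope_restricted_tanh (R : realType) : slope_restricted 0 1 (@tanh R).
Proof.
move=> x y; wlog ltyx : x y / y < x => [slope neqxy|_].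
  case: (ltgtP x y) neqxy => // ltxy _; last by apply: slope; rewrite // gt_eqF.
  rewrite -(opprB y) -(opprB (tanh y)) invrN mulrNN.
  by apply: slope; rewrite // gt_eqF.
have [||c _ ->] := @MVT R (@tanh R) (fun z => 1 - tanh z ^+ 2) y x ltyx.
- by move=> z _; exact: (is_derive_tanh _ z).
- by apply: derivable_within_continuous => z _; case: (is_derive_tanh _ z).
rewrite mulfK ?subr_eq0 ?gt_eqF //.
by have := tanh_sqr_le1 _ c; have := sqr_ge0 (tanh c); lra.
Qed.

Lemma tanhN (R : realType) (x : R) : tanh (- x) = - tanh x.
Proof. by rewrite /tanh opprK [X in _ / X]addrC -mulNr opprB. Qed.

Lemma tanh0 (R : realType) : tanh (0 : R) = 0.
Proof. by rewrite /tanh oppr0 subrr mul0r. Qed.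

Lemma tanh_gt0 (R : realType) (x : R) : 0 < x -> 0 < tanh x.
Proof.
by move=> x0; rewrite divr_gt0 ?expR_addN_gt0 // subr_gt0 ltr_expR gtrN.
Qed.

(** Once e^(2x) is written as (e^x)^2, this is a rational identity in a = e^x and b = e^(-x),
    resting on (a + b)^2 + (a - b)^2 = 2(a^2 + b^2). *)
Lemma tanh_double (R : realType) (x : R) :
  tanh (x + x) = 2 * tanh x / (1 + tanh x ^+ 2).
Proof.
have := expR_gt0 x; have := expR_gt0 (- x).
rewrite /tanh opprD !expRD; move: (expR x) (expR (- x)) => a b b0 a0.
have D : a + b != 0 by rewrite gt_eqF ?addr_gt0.
have D2 : a * a + b * b != 0 by rewrite gt_eqF ?addr_gt0 ?mulr_gt0.
field.
rewrite D D2 /= gt_eqF //; have := mulr_gt0 a0 a0; have := mulr_gt0 b0 b0; nra.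
Qed.

Lemma tanh_double_lt (R : realType) (x : R) :
  0 < x -> tanh (x + x) < 2 * tanh x.
Proof.
move=> /(tanh_gt0 _) t0; rewrite tanh_double.
have t1 : 1 < 1 + tanh x ^+ 2 by rewrite ltrDl exprn_gt0.
rewrite ltr_pdivrMr ?(lt_trans ltr01) // ltr_pMr // mulr_gt0 //.
Qed.

Lemma enorm1E (R : realType) (v : 'cV[R]_1) : enorm v = `|v 0 0|.
Proof. by rewrite /enorm big_ord1 sqrtr_sqr. Qed.

(** The form is the square of the scalar w^T v. *)
Lemma sqr_form_ge0 (R : realType) (n : nat) (w v : 'cV[R]_n) :
  0 <= (v^T *m (w *m w^T) *m v) 0 0.
Proof.
have -> : v^T *m (w *m w^T) *m v = (w^T *m v)^T *m (w^T *m v).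
  by rewrite trmx_mul trmxK !mulmxA.
by rewrite mxE big_ord1 mxE -expr2 sqr_ge0.
Qed.

(** The coefficients are the indicator of the pair (i, j). Since i < j, it vanishes on the diagonal
    and selects one term of the double sum. *)
Lemma coupling_edge (R : realType) (n : nat) (i j : 'I_n) : (i < j)%N ->
  coupling ((basis R i - basis R j) *m (basis R i - basis R j)^T).
Proof.
move=> ltij; exists (fun k l => ((k == i) && (l == j))%:R); split=> [k l _|].
  exact: ler0n.
rewrite [X in _ = X + _]big1 => [|k _]; last first.
  case: eqP => [->|]; last by rewrite scale0r.
  by rewrite -val_eqE (ltn_eqF ltij) scale0r.
rewrite add0r (bigD1 i) //= (bigD1 j) //= !eqxx scale1r.
rewrite big1 ?big1 ?addr0 // => [k ki|l /andP[_ /negPf ->]]; last by rewrite scale0r.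
by rewrite big1 // => l _; rewrite (negPf ki) scale0r.
Qed.

(** The matrix reduces to diag(-rho I, -w w^T), whose quadratic form at (x, y) is -(rho |x|^2 + (w^T
    y)^2). *)
Lemma neg_semidef_P1_rank1 (R : realType) (n0 n1 : nat) (W0 : 'M[R]_(n1, n0))
    (w : 'cV[R]_n1) (rho : R) : w^T *m W0 = 0 -> 0 <= rho ->
  neg_semidef (P1 0 1 W0 w^T rho (w *m w^T)).
Proof.
move=> wW0 rho0.
have W0w : W0^T *m w = 0 by rewrite -[w]trmxK -trmx_mul wW0 trmx0.
have -> : P1 0 1 W0 w^T rho (w *m w^T) =
    block_mx (- rho%:M) 0 0 (- (w *m w^T)).
  rewrite /P1 trmxK !mulr0 mul0r oppr0 scale0r add0r mulmxA W0w mul0mx scaler0.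
  rewrite -mulmxA wW0 mulmx0 scaler0; congr block_mx.
  by rewrite scaler_nat mulr2n opprD addrNK.
split.
  by rewrite tr_block_mx !trmx0 !linearN /= tr_scalar_mx trmx_mul trmxK.
move=> v; rewrite -[v]vsubmxK; move: (usubmx v) (dsubmx v) => x y.
rewrite tr_col_mx mul_row_block !mulmx0 addr0 add0r mul_row_col.
rewrite !mulmxN !mulNmx mxE [X in X + _]mxE [X in _ + X]mxE -opprD.
rewrite oppr_le0 addr_ge0 //.
  rewrite mul_mx_scalar -scalemxAl mxE mulr_ge0 // mxE sumr_ge0 // => i _.
  by rewrite mxE -expr2 sqr_ge0.
exact: sqr_form_ge0.
Qed.

Theorem mainTheorem2 (R : realType) :
  let W0 : 'M[R]_(2, 1) := \col_(i < 2) (-1) in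
  let b0 : 'cV[R]_2 := \col_(i < 2) (if i == 0 then -1 else 1) in
  let W1 : 'M[R]_(1, 2) := \row_(j < 2) (if j == 0 then -1 else 1) in
  let b1 : 'cV[R]_1 := (- (1 / 2))%:M in
  let f : R -> R := fun x => network (@tanh R) W0 b0 W1 b1 x%:M 0 0 in
  let T : 'M[R]_2 :=
    (basis R (0 : 'I_2) - basis R (1 : 'I_2)) *m
    (basis R (0 : 'I_2) - basis R (1 : 'I_2))^T in
  slope_restricted 0 1 (@tanh R) /\
  coupling T /\
  (forall L : R, 0 < L -> neg_semidef (P1 0 1 W0 W1 (L ^+ 2) T)) /\
  (exists L : R, 0 < L /\
     exists x y : R, ~ (`|f x - f y| <= L * `|x - y|)) /\
  ~ (forall (n0 n1 n2 : nat)
       (V0 : 'M[R]_(n1, n0)) (c0 : 'cV[R]_n1)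
       (V1 : 'M[R]_(n2, n1)) (c1 : 'cV[R]_n2) (L : R),
       0 < L ->
       (exists S : 'M[R]_n1,
          coupling S /\ neg_semidef (P1 0 1 V0 V1 (L ^+ 2) S)) ->
       lipschitz_bound L (network (@tanh R) V0 c0 V1 c1)).
Proof.
move=> W0 b0 W1 b1 f T.
have cT : coupling T by exact: coupling_edge.
have nsd L : 0 < L -> neg_semidef (P1 0 1 W0 W1 (L ^+ 2) T).
  (* The sign of [w] is chosen so that its transpose is [W1] = (-1, 1); [T] is unchanged under
     negating [w]. *)
  move=> L0; pose w := basis R (1 : 'I_2) - basis R (0 : 'I_2).
  have -> : T = w *m w^T by rewrite /T -opprB linearN /= mulNmx mulmxN opprK.
  have -> : W1 = w^T.
    apply/matrixP => i j; rewrite !mxE !ord1 !andbT.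
    by case: j => [[|[|//]]] ? /=; rewrite ?subr0 ?sub0r.
  apply: neg_semidef_P1_rank1; rewrite ?exprn_ge0 ?ltW //.
  apply/matrixP => i j; rewrite !mxE !big_ord_recl big_ord0 !mxE /=.
  by rewrite !ord1 /=; ring.
have fE x : f x = - tanh (- x - 1) + tanh (- x + 1) - 1 / 2.
  rewrite /f /network !mxE !big_ord_recl big_ord0 !mxE /= !big_ord1 !mxE /=.
  by rewrite !mulr1n !mulN1r !mul1r addr0.
(* Here f(0) = 2 tanh 1 - 1/2 and f(1) = tanh 2 - 1/2. *)
have f01 : f 1 < f 0.
  rewrite !fE oppr0 !add0r addNr -opprD !tanhN tanh0.
  by have := tanh_double_lt R 1 ltr01; lra.
(* As |0 - 1| = 1, any positive constant below the gap f(0) - f(1) fails as a Lipschitz bound; half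
   the gap is one. *)
pose L := (f 0 - f 1) / 2.
have L0 : 0 < L by rewrite divr_gt0 // subr_gt0.
have nlip : ~ (`|f 0 - f 1| <= L * `|0 - 1|).
  by rewrite sub0r normrN1 mulr1 gtr0_norm ?subr_gt0 // /L; lra.
split; first exact: slope_restricted_tanh.
split=> //; split=> //; split; first by exists L; split=> //; exists 0, 1.
(* The general implication, applied to this network and [T], would give the refuted inequality at 0
   and 1, since [enorm] is the absolute value in dimension 1. *)
move=> lip; apply: nlip.
have := lip 1%N 2%N 1%N W0 b0 W1 b1 L L0 (ex_intro _ T (conj cT (nsd L L0))).
have subE (A B : 'cV[R]_1) : (A - B) 0 0 = A 0 0 - B 0 0 by rewrite !mxE.
move=> /(_ 0%:M 1%:M); rewrite !enorm1E !subE.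
by rewrite [X in _ * `|X - _|]mxE [X in _ * `|_ - X|]mxE !mulr1n.
Qed.
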